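(* Let $(\chi,\rho)$ be a complete separable metric space and let $P$ be a transition probability operator on $\chi$ having a density $p$ with respect to some reference measure $\lambda$, i.e. $P(x,dz)=p(x,z)\,\lambda(dz)$. Let $\mu$ be any probability distribution on $\chi$ and let $\pi$ be a stationary probability distribution for $P$. (a) Assume that there is a constant $A$ such that $$\int_\chi|p(x,z)-p(y,z)|\,\lambda(dz)\le A\,\rho(x,y)\qquad\text{for all }x,y\in\chi.$$ Then $d_{\mathrm{TV}}(\mu P^n,\pi)\le\frac A2\,d_{\mathrm{W}}(\mu P^{n-1},\pi)$ for all $n\ge1$. (b) Assume that the following conditions hold: (i) there exists a (measurable) function $h>0$ on $\chi$ such that $$\int_\chi|p(x,z)-p(y,z)|\,\lambda(dz)\le\frac{\rho(x,y)}{\max\{h(x),h(y)\}}\qquad\text{for all }x,y\in\chi;$$ (ii) there exist positive constants $B$, $q$ and $\epsilon_0$ such that $\pi(\{y: h(y)<\epsilon\})\le B\epsilon^q$ for all $\epsilon\in(0,\epsilon_0)$. Let $\tilde C=(2q)^{-q/(1+q)}\max\{(q+1)B^{1/(1+q)},\ B^{-q/(1+q)}\epsilon_0^{-q}\}$. Then $$d_{\mathrm{TV}}(\mu P^n,\pi)\le\tilde C\,\bigl[d_{\mathrm{W}}(\mu P^{n-1},\pi)\bigr]^{q/(1+q)}\qquad\text{for all }n\ge1.$$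
   Context: For probability measures $\mu_1,\mu_2$ on $(\chi,\rho)$: $d_{\mathrm{W}}(\mu_1,\mu_2)=\inf_M\int\int\rho(x,y)\,M(dx,dy)$, the infimum being over all probability measures $M$ on $\chi\times\chi$ with marginals $\mu_1$ and $\mu_2$; and $d_{\mathrm{TV}}(\mu_1,\mu_2)=\sup_A|\mu_1(A)-\mu_2(A)|$ over measurable $A\subset\chi$. $\mu P^n$ denotes the law after $n$ steps of the Markov chain with kernel $P$ and initial law $\mu$ (with $\mu P^0=\mu$). *)

(* Defs.v *)
From HB Require Import structures.
From mathcomp Require Import all_boot all_order all_algebra.
From mathcomp Require Import all_classical all_reals all_analysis.

Set Implicit Arguments.
Unset Strict Implicit.
Unset Printing Implicit Defensive.

Import Order.TTheory GRing.Theory Num.Theory.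
Import numFieldNormedType.Exports.

Local Open Scope classical_set_scope.
Local Open Scope ring_scope.
Local Open Scope ereal_scope.

#[short(type="completeMetricType")]
HB.structure Definition CompleteMetric (R : numDomainType) :=
  { T of Complete T & Metric R T }.

Definition separable_space (T : topologicalType) : Prop :=
  exists2 D : set T, countable D & dense D.

(* [T] as a measurable space, equipped with its Borel sigma-algebra. *)
Notation borel T := (g_sigma_algebraType (@open T)).

Section kernel_action.
Context d (T : measurableType d) (R : realType).
Variables (mu : probability T R) (P : R.-pker T ~> T).

Definition kact (A : set T) : \bar R := \int[mu]_x P x A.

Let kact0 : kact set0 = 0.
Proof. by rewrite /kact integral0_eq. Qed.

Let kact_ge0 A : 0 <= kact A.
Proof. exact: integral_ge0. Qed.

Let kact_sigma_additive : semi_sigma_additive kact.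
Proof.
move=> F mF tF mUF; rewrite /kact.
rewrite (_ : \int[mu]_x _ = \int[mu]_x (\sum_(0 <= n <oo) P x (F n))); last first.
  apply: eq_integral => x _.
  by apply/esym/cvg_lim => //; exact: measure_semi_sigma_additive.
apply/cvg_closeP; split.
  by apply: is_cvg_nneseries => n _ _; exact: integral_ge0.
by rewrite closeE// integral_nneseries// => n; exact: measurable_kernel.
Qed.

HB.instance Definition _ :=
  isMeasure.Build _ _ R kact kact0 kact_ge0 kact_sigma_additive.

Let kact_setT : kact [set: T] = 1.
Proof.
rewrite /kact (eq_integral (cst 1)); last by move=> x _; rewrite prob_kernel.
by rewrite integral_cst// mul1e; exact: probability_setT.
Qed.

HB.instance Definition _ := Measure_isProbability.Build _ _ R kact kact_setT.

End kernel_action.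

Definition stationary d (T : measurableType d) (R : realType)
    (P : R.-pker T ~> T) (pi : probability T R) : Prop :=
  forall A : set T, measurable A -> kact pi P A = pi A.

Fixpoint chain_law d (T : measurableType d) (R : realType)
    (mu : probability T R) (P : R.-pker T ~> T) (n : nat) : probability T R :=
  if n is m.+1 then kact (chain_law mu P m) P else mu.

Definition dTV d (T : measurableType d) (R : realType)
    (mu1 mu2 : probability T R) : \bar R :=
  ereal_sup [set `|mu1 A - mu2 A| | A in (measurable : set (set T))].

Definition coupling d (T : measurableType d) (R : realType)
    (mu1 mu2 : probability T R) (M : probability (T * T)%type R) : Prop :=
  forall A : set T, measurable A ->
    M (fst @^-1` A) = mu1 A /\ M (snd @^-1` A) = mu2 A.

(* The distance may be infinite, hence its value in [\bar R]. *)
Definition dW (R : realType) (T : completeMetricType R)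
    (mu1 mu2 : probability (borel T) R) : \bar R :=
  ereal_inf [set \int[M]_z (mdist (z.1 : T) (z.2 : T))%:E
            | M in coupling mu1 mu2].

Definition kernel_density d (T : measurableType d) (R : realType)
    (P : R.-pker T ~> T) (lambda : {measure set T -> \bar R})
    (p : T -> T -> R) : Prop :=
  [/\ forall x z, (0 <= p x z)%R,
      forall x, measurable_fun [set: T] (p x)
    & forall x (A : set T), measurable A ->
        P x A = \int[lambda]_(z in A) (p x z)%:E].

(* Main.v *)
Require Import Defs.
From HB Require Import structures.
From mathcomp Require Import all_boot all_order all_algebra.
From mathcomp Require Import all_classical all_reals all_analysis.
From mathcomp Require Import measurable_realfun lra ring.

(** Take a coupling [M] of the law [nu] of the chain at time [n - 1] with [pi].
    Since [pi] is invariant, running one step of the chain from both coordinates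
    gives, for every event [S],
      [|nu P (S) - pi (S)| <= \int |P x S - P y S| M(dx, dy)]
    ([kact_diff_le]).  So the one-step bound on [|P x S - P y S|] decides the
    theorem.  Both [P x] and [P y] have mass one, so this difference is at most
    half of the L^1 distance of the densities ([kernel_diff_le_density]).

    Under (a) the integrand is at most [A / 2] times the distance, and the
    infimum over [M] is the claim.

    Under (b) the bound [mdist x y / (2 * max (h x) (h y))] is useless where [h]
    is small.  Given a threshold [eps], the points are split according to [y],
    whose law is [pi]: where [h y < eps] the trivial bound 1 costs
    [pi {h < eps} <= B * eps^q], and elsewhere the bound is at most
    [mdist x y / (2 * eps)].  Hence
      [dTV <= B * eps^q + dW / (2 * eps)   for 0 < eps < eps0],
    and the constant of the theorem is what comes out of minimizing the right
    side over [eps] ([powR_tradeoff]).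

    Both parts are instances of one estimate ([dTV_le_dW]), with an exceptional
    set [E] that is empty in (a) and equal to [{h < eps}] in (b).  Separability
    enters through [measurable_mdist]: it makes the distance measurable for the
    product of the Borel sigma-algebras. *)

Set Implicit Arguments.
Unset Strict Implicit.
Unset Printing Implicit Defensive.

Import Order.TTheory GRing.Theory Num.Theory.
Import numFieldNormedType.Exports.

Local Open Scope classical_set_scope.
Local Open Scope ring_scope.
Local Open Scope ereal_scope.

(** * Measurability of the distance *)

Lemma open_mdist_lt (R : realFieldType) (T : metricType R) (a : T) (r : R) :
  open [set y : T | (mdist a y < r)%R].
Proof.
rewrite openE => y /= ayr; apply/nbhs_ballP.
exists (r - mdist a y)%R; first by rewrite /= subr_gt0.
move=> z; rewrite ballEmdist /= ltrBrDl => yz.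
exact: le_lt_trans (metric_triangle _ _ _) yz.
Qed.

(** By the triangle inequality and the density of [e 0, e 1, ...], one has
    [mdist x y < r] exactly when [mdist (e n) x < q] and [mdist (e n) y < r - q]
    for some [n] and some rational [q]: the sublevel sets of the distance are
    countable unions of measurable rectangles. *)
Lemma measurable_mdist (R : realType) (T : completeMetricType R) :
  separable_space T ->
  measurable_fun [set: borel T * borel T]
    (fun z => mdist (z.1 : T) (z.2 : T)).
Proof.
move=> [D /pcard_surjP [e eD] dD].
pose U (a : T) (r : R) : set (borel T) := [set y : T | (mdist a y < r)%R].
have mU a r : measurable (U a r).
  by apply: sub_sigma_algebra; exact: open_mdist_lt.
apply: (measurability _ (RGenInftyO.measurableE R)) => //.
move=> _ [_ [r ->] <-]; rewrite setTI.
rewrite [X in measurable X](_ : _ = \bigcup_n \bigcup_(q : rat)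
    (U (e n) (ratr q) `*` U (e n) (r - ratr q)%R)).
  apply: bigcupT_measurable => n; apply: bigcupT_measurable_rat => q.
  exact: measurableX.
apply/seteqP; split => [[x y] /=|[x y] [n _ [q _ []]] /=]; rewrite in_itv /=.
  move=> xyr.
  (* A point of the dense set closer to [x] than half of the slack
     [r - mdist x y] leaves room for a rational [q]. *)
  have [a [/= xa Da]] :
      [set a : T | (mdist x a < (r - mdist x y) / 2)%R] `&` D !=set0.
    apply: dD; last exact: open_mdist_lt.
    by exists x; rewrite /= mdistxx divr_gt0 ?subr_gt0.
  have [q] := rat_in_itvoo xa; rewrite in_itv /= => /andP[xq qr].
  have [n _ ena] := eD _ Da.
  exists n => //; exists q => //; rewrite ena; split; rewrite /U /=.
    by rewrite metric_sym.
  apply: le_lt_trans (metric_triangle _ x _) _.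
  rewrite (metric_sym a x); lra.
rewrite /U /= => xq yq; apply: le_lt_trans (metric_triangle _ (e n) _) _.
rewrite (metric_sym x); lra.
Qed.

(** * Events under one step of the kernel *)

Lemma pker_le1 d (T : measurableType d) (R : realType) (P : R.-pker T ~> T)
    (x : T) (A : set T) : measurable A -> P x A <= 1.
Proof.
move=> mA; rewrite -(prob_kernel (s := P) x).
by apply: le_measure; rewrite ?inE.
Qed.

Lemma pker_diff_le1 d (T : measurableType d) (R : realType) (P : R.-pker T ~> T)
    (x y : T) (A : set T) : measurable A -> `|P x A - P y A| <= 1.
Proof.
move=> mA.
have P0 z : 0 <= P z A by exact: measure_ge0.
move: (P0 x) (P0 y) (pker_le1 P x mA) (pker_le1 P y mA).
case: (P x A) => [a| |]; case: (P y A) => [b| |]; rewrite ?leye_eq//.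
rewrite !lee_fin => a0 b0 a1 b1; rewrite ler_norml; lra.
Qed.

Section density.
Context d (T : measurableType d) (R : realType) (P : R.-pker T ~> T)
  (lambda : {measure set T -> \bar R}) (p : T -> T -> R).
Hypothesis P_density : kernel_density P lambda p.

Let integrable_density x (A : set T) : measurable A ->
  lambda.-integrable A (EFin \o p x).
Proof.
have [p0 mp Pp] := P_density => mA.
apply: (@integrableS _ _ _ _ setT) => //.
apply/integrableP; split; first exact/measurable_EFinP.
rewrite (eq_integral (EFin \o p x)); last first.
  by move=> z _; rewrite /= ger0_norm.
by rewrite -Pp // prob_kernel ltry.
Qed.

(** The factor 1/2 comes from the common mass one of [P x] and [P y]: the
    differences [P x A - P y A] and [P x (~` A) - P y (~` A)] are opposite, and
    they are bounded by the integrals over the disjoint sets [A] and [~` A]. *)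
Lemma kernel_diff_le_density x y (A : set T) : measurable A ->
  `|P x A - P y A| <= (2^-1)%:E * \int[lambda]_z `|p x z - p y z|%:E.
Proof.
move=> mA; have [p0 mp Pp] := P_density.
have mp_xy : measurable_fun setT (fun z => p x z - p y z)%R.
  exact: measurable_funB.
have diff_le B : measurable B ->
    `|P x B - P y B| <= \int[lambda]_(z in B) `|p x z - p y z|%:E.
  move=> mB; rewrite !Pp// -integralB_EFin//; try exact: integrable_density.
  apply: le_trans (le_abse_integral _ _ _) _ => //.
  apply/measurable_EFinP; exact: measurable_funTS.
have PC z : P z A + P z (~` A) = 1.
  rewrite -measureU ?setUv ?setICr//; [exact: prob_kernel|exact: measurableC].
rewrite lee_pdivlMl// -[setT](setUv A) ge0_integral_setU//.
- rewrite mule_natl mule2n leeD ?diff_le//.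
  apply: le_trans (diff_le _ (measurableC mA)).
  move: (PC x) (PC y) (measure_ge0 (P x) A) (measure_ge0 (P y) A).
  case: (P x A) => [a| |]; case: (P x (~` A)) => [b| |]//;
  case: (P y A) => [a'| |]; case: (P y (~` A)) => [b'| |]// [ab] [ab'] _ _.
  by rewrite /= lee_fin (_ : b - b' = - (a - a'))%R ?normrN//; lra.
- exact: measurableC.
- apply/measurable_EFinP; apply: measurable_funTS; exact: measurableT_comp.
- by rewrite disj_set2E setICr.
Qed.
End density.

(** * Couplings *)

Section coupling.
Context d (T : measurableType d) (R : realType).
Variables (mu1 mu2 : probability T R) (M : probability (T * T)%type R).
Hypothesis M_coupling : coupling mu1 mu2 M.

Lemma coupling_integral_fst (f : T -> \bar R) :
  measurable_fun [set: T] f -> (forall x, 0 <= f x) ->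
  \int[mu1]_x f x = \int[M]_z f z.1.
Proof.
move=> mf f0.
rewrite (eq_measure_integral (pushforward M fst)); last first.
  by move=> A mA _; apply: esym; exact: (M_coupling mA).1.
by rewrite ge0_integral_pushforward.
Qed.

Lemma coupling_integral_snd (f : T -> \bar R) :
  measurable_fun [set: T] f -> (forall x, 0 <= f x) ->
  \int[mu2]_x f x = \int[M]_z f z.2.
Proof.
move=> mf f0.
rewrite (eq_measure_integral (pushforward M snd)); last first.
  by move=> A mA _; apply: esym; exact: (M_coupling mA).2.
by rewrite ge0_integral_pushforward.
Qed.

(** Both laws are integrals of [P ^~ A], which the coupling rewrites as integrals
    of functions of [z.1] and [z.2] against the same measure [M]. *)
Lemma kact_diff_le (P : R.-pker T ~> T) (A : set T) : measurable A ->
  `|kact mu1 P A - kact mu2 P A| <= \int[M]_z `|P z.1 A - P z.2 A|.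
Proof.
move=> mA; rewrite /kact.
have mP : measurable_fun setT (P ^~ A) by exact: measurable_kernel.
have mP1 : measurable_fun setT (fun z : T * T => P z.1 A).
  by apply: (measurableT_comp mP).
have mP2 : measurable_fun setT (fun z : T * T => P z.2 A).
  by apply: (measurableT_comp mP).
rewrite coupling_integral_fst// coupling_integral_snd//.
have iP (f : T * T -> T) : measurable_fun setT (fun z => P (f z) A) ->
    M.-integrable setT (fun z => P (f z) A).
  move=> mf; apply/integrableP; split => //.
  apply: (@le_lt_trans _ _ (\int[M]_z cst 1 z)).
    apply: ge0_le_integral => //; first exact: measurableT_comp.
    by move=> z _; rewrite gee0_abs// pker_le1.
  by rewrite integral_cst// mul1e (le_lt_trans (probability_le1 _ _))// ltry.
rewrite -integralB//; try exact: iP.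
apply: le_abse_integral => //; exact: emeasurable_funB.
Qed.

End coupling.

(** Guarantees that the infimum defining [dW] is over a nonempty set, which is
    what makes [dTV_le_dW] hold even for [c = 0]. *)
Lemma product_coupling d (T : measurableType d) (R : realType)
    (mu1 mu2 : probability T R) :
  coupling mu1 mu2 (mu1 \x mu2)%E.
Proof.
move=> A mA; split.
  rewrite (_ : fst @^-1` A = A `*` setT); last by rewrite setXT.
  by rewrite [LHS]product_measure1E// [X in _ * X](probability_setT mu2) mule1.
rewrite (_ : snd @^-1` A = setT `*` A); last by rewrite setTX.
by rewrite [LHS]product_measure1E// [X in X * _](probability_setT mu1) mul1e.
Qed.
Lemma dW_ge0 (R : realType) (T : completeMetricType R)
    (mu1 mu2 : probability (borel T) R) : 0 <= dW mu1 mu2.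
Proof.
apply: le_ereal_inf_tmp => _ [M _ <-]; apply: integral_ge0 => z _.
by rewrite lee_fin mdist_ge0.
Qed.

(** * From the Wasserstein distance to total variation *)

Section bound.
Context (R : realType) (T : completeMetricType R).
Hypothesis T_separable : separable_space T.
Context (P : R.-pker (borel T) ~> (borel T)) (nu pi : probability (borel T) R).
Hypothesis pi_stationary : stationary P pi.

(** The exceptional set [E] constrains the second point only, because its law
    under a coupling is [pi]: the integral of [\1_E] is then [pi E] for every
    coupling, and survives the infimum unchanged. *)
Lemma dTV_le_dW (E : set (borel T)) (c : R) :
  measurable E -> (0 <= c)%R ->
  (forall (x y : T) (A : set (borel T)), measurable A -> 
     `|P x A - P y A| <= (\1_E y + c * mdist x y)%:E) ->
  dTV (kact nu P) pi <= pi E + c%:E * dW nu pi.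
Proof.
move=> mE c0 Pc; apply: ge_ereal_sup => _ [A mA <-].
rewrite -pi_stationary//.
have step M : coupling nu pi M ->
    `|kact nu P A - kact pi P A| <=
      pi E + c%:E * \int[M]_z (mdist (z.1 : T) (z.2 : T))%:E.
  move=> cM; apply: le_trans (kact_diff_le cM P mA) _.
  have mP : measurable_fun setT (P ^~ A) by exact: measurable_kernel.
  have md : measurable_fun [set: borel T * borel T]
      (fun z => (mdist (z.1 : T) (z.2 : T))%:E).
    by apply/measurable_EFinP; exact: measurable_mdist.
  have mI : measurable_fun [set: borel T] (fun y => (\1_E y : R)%:E).
    by apply/measurable_EFinP; exact: measurable_indic.
  rewrite -(setIT E) -integral_indic// (coupling_integral_snd cM)//.
  rewrite -ge0_integralZl_EFin//; last by move=> z _; rewrite lee_fin mdist_ge0.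
  rewrite -ge0_integralD//.
  - apply: ge0_le_integral => //.
    + apply: measurableT_comp => //; apply: emeasurable_funB.
      * exact: (measurableT_comp mP).
      * exact: (measurableT_comp mP).
    + apply: emeasurable_funD; last exact: measurable_funeM.
      exact: (measurableT_comp mI).
    + by move=> z _; rewrite -EFinM -EFinD; exact: Pc.
  - exact: (measurableT_comp mI).
  - by move=> z _; rewrite mule_ge0// lee_fin mdist_ge0.
  - exact: measurable_funeM.
have [c_eq0|c_neq0] := eqVneq c 0%R.
  (* The distance may be infinite, but [0 * +oo = 0]: any coupling will do. *)
  have := step _ (@product_coupling _ _ _ nu pi).
  by rewrite c_eq0 !mul0e.
have cgt0 : (0 < c)%R by rewrite lt_neqAle eq_sym c_neq0.
have piE : pi E \is a fin_num by exact: fin_num_measure.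
rewrite -leeBlDl// -lee_pdivrMl//; apply: le_ereal_inf_tmp => _ [M cM <-].
by rewrite lee_pdivrMl// leeBlDl//; exact: step.
Qed.
End bound.

(** * Optimizing the threshold *)

(** The function [B * eps^q + w / (2 * eps)] of [eps] has its minimum where
    [eps^(1 + q) = w / (2 * q * B)]; there the second term is [q] times the first,
    which gives the first argument of the maximum.  If this point is beyond
    [eps0], then [w] is so large that the right side, with the second argument of
    the maximum, is at least 1. *)
Lemma powR_tradeoff (R : realType) (B q eps0 w t : R) :
  (0 < B)%R -> (0 < q)%R -> (0 < eps0)%R -> (0 <= w)%R -> (t <= 1)%R ->
  (forall eps : R, (0 < eps < eps0)%R ->
     (t <= B * eps `^ q + (2 * eps)^-1 * w)%R) ->
  (t <= (2 * q) `^ (- q / (1 + q)) *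
        Num.max ((q + 1) * B `^ (1 / (1 + q)))
                (B `^ (- q / (1 + q)) * eps0 `^ (- q)) * w `^ (q / (1 + q)))%R.
Proof.
move=> B0 q0 e0 + t1 H; rewrite le_eqVlt => /predU1P[w0|w0].
  rewrite -w0 powR0 ?mulr0; last by rewrite gt_eqF// divr_gt0// addr_gt0.
  rewrite leNgt; apply/negP => t0.
  (* When [w = 0] the minimizer degenerates to 0, and the bound tends to 0 with
     [eps]; [del] is the threshold at which it equals [t / 2]. *)
  pose del := ((t / (2 * B)) `^ q^-1)%R.
  have del0 : (0 < del)%R by rewrite powR_gt0// divr_gt0// mulr_gt0.
  have delq : (del `^ q = t / (2 * B))%R.
    by rewrite /del -powRrM mulVf ?gt_eqF// powRr1// ltW// divr_gt0// mulr_gt0.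
  pose eps := Num.min del (eps0 / 2)%R.
  have eps_gt0 : (0 < eps)%R by rewrite lt_min del0 divr_gt0.
  have eps_lt : (eps < eps0)%R.
    by rewrite gt_min; apply/orP; right; rewrite ltr_pdivrMr// ltr_pMr// ltr1n.
  have := H eps; rewrite eps_gt0 eps_lt -w0 mulr0 addr0 => /(_ isT).
  have : (eps `^ q <= del `^ q)%R.
    by apply: ge0_ler_powR; rewrite ?nnegrE ?ge_min ?lexx//; exact: ltW.
  rewrite delq -(ler_pM2l B0) => h1 /le_trans /(_ h1).
  rewrite (_ : (B * (t / (2 * B)) = t / 2)%R); first lra.
  field; rewrite gt_eqF//.
have q10 : (0 < 1 + q)%R by rewrite addr_gt0.
pose s := (q / (1 + q))%R.
pose u := (w / (2 * q * B))%R.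
have u0 : (0 < u)%R by rewrite divr_gt0// !mulr_gt0.
pose eps := (u `^ (1 + q)^-1)%R.
have eps_gt0 : (0 < eps)%R by rewrite powR_gt0.
have epsq : (eps `^ q = u `^ s)%R by rewrite /eps -powRrM mulrC.
have epsu : (eps * eps `^ q = u)%R.
  rewrite -{1}(powRr1 (ltW eps_gt0)) -powRD; last by rewrite gt_eqF.
  by rewrite -powRrM mulVf ?gt_eqF// powRr1// ltW.
have uE : (u `^ s = (2 * q) `^ (- s) * B `^ (- s) * w `^ s)%R.
  rewrite !powRN /u powRM ?invr_ge0 ?ltW// ?mulr_gt0//.
  rewrite -powR_inv1 -?powRrM ?mulN1r ?powRN ?ltW ?mulr_gt0//.
  rewrite powRM ?ltW ?mulr_gt0// invfM; ring.
rewrite mulNr -/s -mulrA.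
have [eps_lt|eps_ge] := ltP eps eps0.
  have := H eps; rewrite eps_gt0 eps_lt => /(_ isT) /le_trans; apply.
  have -> : ((2 * eps)^-1 * w = q * B * eps `^ q)%R.
    rewrite (_ : w = 2 * q * B * u)%R; last first.
      by rewrite /u mulrC divfK// gt_eqF// !mulr_gt0.
    rewrite -epsu; field; rewrite gt_eqF//.
  apply: (@le_trans _ _ ((2 * q) `^ (- s) * (((q + 1) * B `^ (1 / (1 + q))) * w `^ s)))%R.
    rewrite epsq uE.
    have -> : (B `^ (1 / (1 + q)) = B * B `^ (- s))%R.
      rewrite -{2}(powRr1 (ltW B0)) -powRD; last by rewrite (gt_eqF B0) implybT.
      congr (_ `^ _)%R; rewrite /s; field; rewrite gt_eqF//.
    by rewrite le_eqVlt; apply/orP; left; apply/eqP; ring.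
  by rewrite ler_pM2l ?powR_gt0 ?mulr_gt0// ler_pM2r ?powR_gt0// le_max lexx.
apply: (le_trans t1).
apply: (@le_trans _ _ ((2 * q) `^ (- s) * ((B `^ (- s) * eps0 `^ (- q)) * w `^ s)))%R.
  rewrite [leRHS](_ : _ = eps0 `^ (- q) * u `^ s)%R; last by rewrite uE; ring.
  rewrite powRN mulrC ler_pdivlMr ?powR_gt0// mul1r -epsq.
  by apply: ge0_ler_powR; rewrite ?nnegrE ?(ltW q0) ?(ltW e0) ?(ltW eps_gt0).
by rewrite ler_pM2l ?powR_gt0 ?mulr_gt0// ler_pM2r ?powR_gt0// le_max lexx orbT.
Qed.

Unset Implicit Arguments.

Theorem theorem12 (R : realType) (T : completeMetricType R)
    (T_separable : separable_space T)
    (P : R.-pker (borel T) ~> (borel T))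
    (lambda : {measure set (borel T) -> \bar R})
    (p : borel T -> borel T -> R)
    (P_density : kernel_density P lambda p)
    (mu pi : probability (borel T) R)
    (pi_stationary : stationary P pi) :
  (forall A : R,
     (forall x y : T,
        \int[lambda]_z `|p x z - p y z|%:E <= (A * mdist x y)%:E) ->
     forall n : nat, (1 <= n)%N ->
       dTV (chain_law mu P n) pi
         <= (A / 2)%:E * dW (chain_law mu P n.-1) pi)
  /\
  (forall (h : borel T -> R) (B q eps0 : R),
     measurable_fun [set: borel T] h ->
     (forall x : T, (0 < h x)%R) ->
     (forall x y : T,
        \int[lambda]_z `|p x z - p y z|%:E
          <= (mdist x y / Num.max (h x) (h y))%:E) ->
     (0 < B)%R -> (0 < q)%R -> (0 < eps0)%R ->
     (forall eps : R, (0 < eps < eps0)%R ->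
        pi [set y | (h y < eps)%R] <= (B * eps `^ q)%:E) ->
     let C : R :=
       ((2 * q) `^ (- q / (1 + q)) *
        Num.max ((q + 1) * B `^ (1 / (1 + q)))
                (B `^ (- q / (1 + q)) * eps0 `^ (- q)))%R in
     forall n : nat, (1 <= n)%N ->
       dTV (chain_law mu P n) pi
         <= C%:E * (dW (chain_law mu P n.-1) pi) `^ (q / (1 + q))).
Proof.
split=> [A PA|h B q eps0 mh h0 Ph B0 q0 e0 piB C] [//|n] _ /=;
  set nu := chain_law mu P n.
- have [A0|A0] := leP 0%R A.
    rewrite -[leRHS]add0e -(measure0 pi).
    apply: dTV_le_dW => //; first by rewrite divr_ge0.
    move=> x y S mS; rewrite indic0 add0r.
    apply: le_trans (kernel_diff_le_density P_density x y mS) _.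
    rewrite lee_pdivrMl// -EFinM.
    by rewrite (_ : 2 * (A / 2 * _) = A * mdist x y)%R//; field.
  (* If [A < 0], then [0 <= A * mdist x y] forces every distance to vanish,
     and both sides are 0. *)
  have d0 (x y : T) : mdist x y = 0%R.
    apply/eqP; rewrite eq_le mdist_ge0 andbT -(@nmulr_rge0 _ A)//.
    rewrite -lee_fin; apply: le_trans (PA x y); exact: integral_ge0.
  have W0 : dW nu pi = 0.
    apply/eqP; rewrite eq_le dW_ge0 andbT.
    apply: ge_ereal_inf; exists 0 => //.
    exists (nu \x pi)%E; first exact: product_coupling.
    by rewrite integral0_eq// => z _; rewrite d0.
  rewrite W0 mule0 -[leRHS]add0e -{1}(measure0 pi) -(mul0e (dW nu pi)).
  apply: dTV_le_dW => // x y S mS; rewrite indic0 add0r mul0r.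
  apply: le_trans (kernel_diff_le_density P_density x y mS) _.
  by rewrite lee_pdivrMl// mule0; apply: le_trans (PA x y) _; rewrite d0 mulr0.
- have W0 : 0 <= dW nu pi by exact: dW_ge0.
  have q10 : (0 < 1 + q)%R by rewrite addr_gt0.
  have C0 : (0 < C)%R.
    rewrite mulr_gt0 ?powR_gt0 ?mulr_gt0// lt_max; apply/orP; left.
    by rewrite mulr_gt0 ?powR_gt0 ?addr_gt0.
  have trade (eps : R) : (0 < eps < eps0)%R ->
      dTV (kact nu P) pi <= (B * eps `^ q)%:E + ((2 * eps)^-1)%:E * dW nu pi.
    move=> /andP[eps_gt0 eps_lt].
    have mE : measurable [set y : borel T | (h y < eps)%R].
      by have := mh measurableT _ (measurable_itv `]-oo, eps[); rewrite setTI.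
    apply: (@le_trans _ _ (pi [set y | (h y < eps)%R] +
        ((2 * eps)^-1)%:E * dW nu pi)); last first.
      by rewrite leeD2r// piB// eps_gt0.
    apply: dTV_le_dW => //; first by rewrite invr_ge0 mulr_ge0// ltW.
    move=> x y S mS; rewrite indicE; have [yE|yE] := boolP (y \in _).
      apply: le_trans (pker_diff_le1 P x y mS) _.
      by rewrite lee_fin lerDl mulr_ge0 ?mdist_ge0// invr_ge0 mulr_ge0// ltW.
    rewrite add0r; apply: le_trans (kernel_diff_le_density P_density x y mS) _.
    rewrite lee_pdivrMl//; apply: le_trans (Ph x y) _.
    have hy : (eps <= Num.max (h x) (h y))%R.
      rewrite le_max; apply/orP; right; rewrite leNgt.
      by move: yE; rewrite notin_setE /= => /negP.
    rewrite -EFinM lee_fin invfM mulrA mulrA divff// mul1r mulrC.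
    by rewrite ler_wpM2r ?mdist_ge0// lef_pV2// posrE ?(lt_le_trans eps_gt0).
  (* The exceptional set is now the whole space. *)
  have t1 : dTV (kact nu P) pi <= 1.
    rewrite -[leRHS]adde0 -{1}(probability_setT pi) -(mul0e (dW nu pi)).
    apply: dTV_le_dW => // x y S mS.
    by rewrite indicT mul0r addr0; exact: pker_diff_le1.
  case: (dW nu pi) W0 trade => [w| |//] W0 trade; last first.
    rewrite poweRyr; last by rewrite gt_eqF ?divr_gt0.
    by rewrite gt0_muley ?lte_fin// leey.
  rewrite poweR_EFin -EFinM.
  case: (dTV (kact nu P) pi) t1 trade => [t| |]; last 2 first.
    by rewrite leye_eq.
    by move=> *; exact: leNye.
  rewrite !lee_fin in W0 * => t1 trade.
  by apply: powR_tradeoff => // eps /trade; rewrite -EFinM -EFinD lee_fin.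
Qed.
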